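(* Let $\mathcal{P}$ be a PTRS that is non-overlapping, linear and non-erasing. Then $\mathtt{AST}(\xrightarrow{\mathbf{f}}_{\mathcal{P}})$ holds iff $\mathtt{wAST}(\xrightarrow{\mathbf{f}}_{\mathcal{P}})$ holds, and $\mathtt{PAST}(\xrightarrow{\mathbf{f}}_{\mathcal{P}})$ holds iff $\mathtt{wPAST}(\xrightarrow{\mathbf{f}}_{\mathcal{P}})$ holds.
   Context: Terms $\mathcal{T}$ are built from a countable signature $\Sigma$ and countable variable set $\mathcal{V}$. A finite multi-distribution on a set $A\neq\emptyset$ is a finite multiset $\mu$ of pairs $(p:a)$ with $0<p\le 1$, $a\in A$, whose probabilities sum to $1$; $\mathrm{FDist}(A)$ is the set of these, $\mathrm{Supp}(\mu)$ the multiset of the $a$'s, $p\cdot\mu=\{(p\cdot q:a)\mid (q:a)\in\mu\}$. A probabilistic rewrite rule is $\ell\to\mu$ with $\ell\in\mathcal{T}\setminus\mathcal{V}$, $\mu\in\mathrm{FDist}(\mathcal{T})$, $\mathcal{V}(r)\subseteq\mathcal{V}(\ell)$ for all $r\in\mathrm{Supp}(\mu)$; a PTRS is a countable set $\mathcal{P}$ of such rules. $s\xrightarrow{\mathbf{f}}_{\mathcal{P}}\{p_1:t_1,\dots,p_k:t_k\}$ iff there are a position $\pi$, a rule $\ell\to\{p_1:r_1,\dots,p_k:r_k\}\in\mathcal{P}$ and a substitution $\sigma$ with $s|_\pi=\ell\sigma$ and $t_j=s[r_j\sigma]_\pi$. Normal forms are terms admitting no step. Lifting of $\to\subseteq\mathcal{T}\times\mathrm{FDist}(\mathcal{T})$: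 the smallest relation $\rightrightarrows$ on $\mathrm{FDist}(\mathcal{T})$ with $\{1:t\}\rightrightarrows\{1:t\}$ for normal forms $t$; $\{1:t\}\rightrightarrows\mu$ if $t\to\mu$; and $\bigcup_j p_j\cdot\mu_j\rightrightarrows\bigcup_jp_j\cdot\nu_j$ whenever $\mu_j\rightrightarrows\nu_j$, $0<p_j\le1$, $\sum_jp_j=1$. $|\mu|_\to$ = total probability of normal forms in $\mu$; $\mathrm{edl}((\mu_n)_n)=\sum_{n\ge0}(1-|\mu_n|_\to)$. $\mathtt{AST}(\to)$: every infinite $\rightrightarrows$-sequence $(\mu_n)$ has $\lim_n|\mu_n|_\to=1$. $\mathtt{PAST}(\to)$: every infinite $\rightrightarrows$-sequence with $\mu_0=\{1:t\}$ has finite $\mathrm{edl}$. $\mathtt{wAST}(\to)$: for every term $t$ there exists an infinite $\rightrightarrows$-sequence with $\mu_0=\{1:t\}$ and $\lim_n|\mu_n|_\to=1$. $\mathtt{wPAST}(\to)$: for every term $t$ there exists an infinite $\rightrightarrows$-sequence with $\mu_0=\{1:t\}$ and finite $\mathrm{edl}$. Non-overlapping: no two rules (renamed apart) $\ell_1\to\mu_1,\ell_2\to\mu_2$ and non-variable position $\pi$ of $\ell_1$ with $\ell_1|_\pi$, $\ell_2$ unifiable (with $\pi\neq\varepsilon$ if it is the same rule). Linear: no variable occurs twice in a left-hand side nor in any $r\in\mathrm{Supp}(\mu)$. Non-erasing: $\mathcal{V}(\ell)\subseteq\mathcal{V}(r)$ for every rule $\ell\to\mu$ and $r\in\mathrm{Supp}(\mu)$.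 *)

(* Defs.v *)
From HB Require Import structures.
From mathcomp Require Import all_boot all_order all_algebra.
From mathcomp Require Import finmap multiset.
From mathcomp Require Import all_classical all_reals all_analysis.

Set Implicit Arguments.
Unset Strict Implicit.
Unset Printing Implicit Defensive.

Import Order.TTheory GRing.Theory Num.Theory.
Import numFieldNormedType.Exports.

Local Open Scope classical_set_scope.
Local Open Scope ring_scope.

Section Terms.
Variables (F : countType) (ar : F -> nat).

Inductive term (V : Type) : Type :=
| Var of V
| App (f : F) of ('I_(ar f) -> term V).

HB.instance Definition _ (V : Type) := gen_eqMixin (term V).
HB.instance Definition _ (V : Type) := gen_choiceMixin (term V).

Definition is_var (V : Type) (t : term V) : bool :=
  if t is Var _ then true else false.

(* The list of all variable occurrences, with repetitions. *)
Fixpoint vars (V : Type) (t : term V) : seq V :=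
  match t with
  | Var x => [:: x]
  | App f ts => flatten [seq vars (ts i) | i <- enum 'I_(ar f)]
  end.

Fixpoint subst (V W : Type) (sigma : V -> term W) (t : term V) : term W :=
  match t with
  | Var x => sigma x
  | App f ts => App (fun i => subst sigma (ts i))
  end.

Definition rename (V W : Type) (rho : V -> W) : term V -> term W :=
  subst (fun x => Var (rho x)).

(* Positions are sequences of argument indices counted from 0;               *)
(* None means that pi is not a position of t.                                *)
Fixpoint subterm_at (V : Type) (t : term V) (pi : seq nat) : option (term V) :=
  match pi with
  | [::] => Some t
  | i :: pi' =>
      match t with
      | Var _ => None
      | App f ts =>
          if insub i is Some j then subterm_at (ts j) pi' else None
      end
  end.

(* t[u]_pi; only meaningful when pi is a position of t. *)
Fixpoint replace_at (V : Type) (t : term V) (pi : seq nat) (u : term V) :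
    term V :=
  match pi with
  | [::] => u
  | i :: pi' =>
      match t with
      | Var x => Var x
      | App f ts =>
          App (fun j : 'I_(ar f) =>
                 if val j == i then replace_at (ts j) pi' u else ts j)
      end
  end.

Definition unifiable (V : Type) (s t : term V) : Prop :=
  exists sigma : V -> term V, subst sigma s = subst sigma t.

End Terms.

Section MultiDistributions.
Variable R : realType.

Definition is_fdist (A : choiceType) (m : {mset R * A}%mset) : bool :=
  all (fun x => 0 < x.1 <= 1) (enum_mset m) &&
  (\sum_(x <- enum_mset m) x.1 == 1).

Record fdist (A : choiceType) := FDist {
  fdist_mset :> {mset R * A}%mset;
  fdist_mset_subproof : is_fdist fdist_mset
}.

HB.instance Definition _ (A : choiceType) := [isSub for @fdist_mset A].

Definition mset_map (K L : choiceType) (f : K -> L) (m : {mset K}%mset) :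
    {mset L}%mset :=
  seq_mset [seq f x | x <- enum_mset m].

Definition supp (A : choiceType) (mu : fdist A) : {mset A}%mset :=
  mset_map snd mu.

Definition mscale (A : choiceType) (p : R) (m : {mset R * A}%mset) :
    {mset R * A}%mset :=
  mset_map (fun x => (p * x.1, x.2)) m.

Fact dirac_fdist_subproof (A : choiceType) (a : A) :
  is_fdist (msetn 1 ((1 : R), a)).
Proof.
have e : perm_eq (enum_mset (msetn 1 ((1 : R), a))) [:: (1, a)].
  by apply/allP => x _ /=; rewrite count_mem_mset msetnE (eq_sym x) addn0; case: (_ == x).
by rewrite /is_fdist (perm_all _ e) (perm_big _ e) /= big_seq1 ltr01 lexx eqxx.
Qed.

Definition fdirac (A : choiceType) (a : A) : fdist A :=
  FDist (dirac_fdist_subproof a).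

Fact fdist_map_subproof (A B : choiceType) (f : A -> B) (mu : fdist A) :
  is_fdist (mset_map (fun x : R * A => (x.1, f x.2)) mu).
Proof.
have e := perm_eq_seq_mset [seq (x.1, f x.2) | x <- enum_mset mu].
rewrite /is_fdist (perm_all _ e) (perm_big _ e) /= all_map big_map.
exact: fdist_mset_subproof.
Qed.

(* { p_1 : f a_1, ..., p_k : f a_k } for mu = { p_1 : a_1, ..., p_k : a_k };  *)
(* pairs that become equal keep their multiplicities.                        *)
Definition fdist_map (A B : choiceType) (f : A -> B) (mu : fdist A) : fdist B :=
  FDist (fdist_map_subproof f mu).

End MultiDistributions.

Section AbstractReduction.
Variables (R : realType) (A : choiceType) (step : A -> fdist R A -> Prop).

Definition nform (a : A) : Prop := ~ exists mu, step a mu.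

Inductive plift : fdist R A -> fdist R A -> Prop :=
| plift_nf a : nform a -> plift (fdirac R a) (fdirac R a)
| plift_step a mu : step a mu -> plift (fdirac R a) mu
| plift_conv (k : nat) (p : 'I_k -> R) (mus nus : 'I_k -> fdist R A)
    (mu nu : fdist R A) :
    (forall j, plift (mus j) (nus j)) ->
    (forall j, 0 < p j <= 1) ->
    \sum_(j < k) p j = 1 ->
    fdist_mset mu = \big[msetD/mset0]_(j < k) mscale (p j) (mus j) ->
    fdist_mset nu = \big[msetD/mset0]_(j < k) mscale (p j) (nus j) ->
    plift mu nu.

Definition plift_seq (mu : nat -> fdist R A) : Prop :=
  forall n, plift (mu n) (mu n.+1).

Definition nf_prob (mu : fdist R A) : R :=
  \sum_(x <- enum_mset mu | `[< nform x.2 >]) x.1.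

Definition edl (mu : nat -> fdist R A) : \bar R :=
  (\sum_(0 <= n <oo) (1 - nf_prob (mu n))%:E)%E.

Definition AST : Prop :=
  forall mu, plift_seq mu -> nf_prob (mu n) @[n --> \oo] --> (1 : R).

Definition PAST : Prop :=
  forall mu a, plift_seq mu -> mu 0%N = fdirac R a -> (edl mu < +oo)%E.

Definition wAST : Prop :=
  forall a, exists mu, [/\ plift_seq mu, mu 0%N = fdirac R a &
    nf_prob (mu n) @[n --> \oo] --> (1 : R)].

Definition wPAST : Prop :=
  forall a, exists mu, [/\ plift_seq mu, mu 0%N = fdirac R a &
    (edl mu < +oo)%E].

End AbstractReduction.

Section PTRS.
Variables (R : realType) (F : countType) (ar : F -> nat) (V : countType).

Definition prule : Type := (term ar V * fdist R (term ar V))%type.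

Definition is_prule (r : prule) : Prop :=
  ~~ is_var r.1 /\
  forall t, t \in supp r.2 -> {subset vars t <= vars r.1}.

Definition is_ptrs (P : set prule) : Prop :=
  countable P /\ forall r, P r -> is_prule r.

Definition rew (P : set prule) (s : term ar V) (mu : fdist R (term ar V)) :
    Prop :=
  exists (pi : seq nat) (r : prule) (sigma : V -> term ar V),
    [/\ P r, subterm_at s pi = Some (subst sigma r.1) &
        mu = fdist_map (fun t => replace_at s pi (subst sigma t)) r.2].

(* The two rules are renamed apart by moving their variables into the two    *)
(* summands of V + V, so that V itself need not be infinite.                 *)
Definition non_overlapping (P : set prule) : Prop :=
  forall (r1 r2 : prule) (pi : seq nat) (u : term ar V),
    P r1 -> P r2 ->
    subterm_at r1.1 pi = Some u -> ~~ is_var u ->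
    (r1 = r2 -> pi <> [::]) ->
    ~ unifiable (rename (@inl V V) u) (rename (@inr V V) r2.1).

Definition linear_ptrs (P : set prule) : Prop :=
  forall r, P r ->
    uniq (vars r.1) /\ forall t, t \in supp r.2 -> uniq (vars t).

Definition non_erasing (P : set prule) : Prop :=
  forall r, P r -> forall t, t \in supp r.2 -> {subset vars r.1 <= vars t}.

End PTRS.

(* Main.v *)
Require Import Defs.
From mathcomp Require Import all_boot all_order all_algebra.
From mathcomp Require Import finmap multiset.
From mathcomp Require Import all_classical all_reals all_analysis.

(** A non-overlapping, linear and non-erasing PTRS has a strong diamond property:
    two different steps from the same term contract redexes of which each leaves
    exactly one residual in every outcome of the other, so performing both in
    either order gives the same multi-distribution.  By induction on [n], the
    probability of having reached a normal form after exactly [n] steps from a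
    term [t] is then the same for all strategies, since two competing first steps
    can be completed to a common two-step reduct.  Hence the sequences
    [nf_prob (mu n)], and with them almost-sure termination and the expected
    derivation length, do not depend on how the rewrite sequence resolves its
    nondeterminism. *)

Set Implicit Arguments.
Unset Strict Implicit.
Unset Printing Implicit Defensive.

Import Order.TTheory GRing.Theory Num.Theory.
Import numFieldNormedType.Exports.

Local Open Scope classical_set_scope.
Local Open Scope ring_scope.

(** * Expectations over finite multi-distributions *)

Section Expectation.
Variable R : realType.

(** Taken on raw multisets, so that it also applies to scaled pieces and partial unions, whose
    weights need not sum to 1. *)
Definition expect (A : choiceType) (m : {mset R * A}%mset) (f : A -> R) : R :=
  \sum_(x <- enum_mset m) x.1 * f x.2.

Lemma fdist_inj (A : choiceType) (mu nu : fdist R A) :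
  fdist_mset mu = fdist_mset nu -> mu = nu.
Proof. by move=> e; apply/val_inj. Qed.

Lemma mem_mset_map (K L : choiceType) (f : K -> L) (m : {mset K}%mset) a :
  (a \in mset_map f m) = (a \in [seq f x | x <- enum_mset m]).
Proof. exact: perm_mem (perm_eq_seq_mset _) a. Qed.

Lemma mem_supp (A : choiceType) (mu : fdist R A) (x : R * A) :
  x \in enum_mset mu -> x.2 \in supp mu.
Proof. by move=> xmu; rewrite mem_mset_map; exact: map_f. Qed.

Lemma fdist_map_comp (A B C : choiceType) (f : B -> C) (g : A -> B)
    (mu : fdist R A) :
  fdist_map f (fdist_map g mu) = fdist_map (f \o g) mu.
Proof.
apply: fdist_inj; apply/eq_seq_msetP => /=.
rewrite (perm_trans (perm_map _ (perm_eq_seq_mset _))) // -map_comp.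
exact: perm_refl.
Qed.

Lemma eq_in_fdist_map (A B : choiceType) (f g : A -> B) (mu : fdist R A) :
  (forall x, x \in supp mu -> f x = g x) -> fdist_map f mu = fdist_map g mu.
Proof.
move=> fg; apply: fdist_inj; congr seq_mset; apply/eq_in_map => x xmu.
by rewrite fg// mem_supp.
Qed.

Lemma expect_map (A B : choiceType) (f : A -> B) (mu : fdist R A) (g : B -> R) :
  expect (fdist_map f mu) g = expect mu (g \o f).
Proof. by rewrite /expect (perm_big _ (perm_eq_seq_mset _)) big_map. Qed.

Lemma eq_in_expect (A : choiceType) (mu : fdist R A) (f g : A -> R) :
  (forall x, x \in supp mu -> f x = g x) -> expect mu f = expect mu g.
Proof.
by move=> fg; apply: eq_big_seq => x xmu /=; rewrite fg// mem_supp.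
Qed.

Lemma expect_dirac (A : choiceType) (a : A) (f : A -> R) :
  expect (fdirac R a) f = f a.
Proof. by rewrite /expect /= enum_msetn big_seq1 mul1r. Qed.

Lemma expect_const (A : choiceType) (mu : fdist R A) (c : R) :
  expect mu (fun=> c) = c.
Proof.
rewrite /expect -mulr_suml.
by case: mu => m /= /andP[_ /eqP ->]; rewrite mul1r.
Qed.

Lemma exchange_expect (A B : choiceType) (mu : {mset R * A}%mset)
    (nu : {mset R * B}%mset) (f : A -> B -> R) :
  expect mu (fun a => expect nu (f a)) = expect nu (fun b => expect mu (f^~ b)).
Proof.
rewrite /expect; under eq_bigr do rewrite big_distrr.
rewrite exchange_big /=; apply: eq_bigr => y _; rewrite big_distrr /=.
by apply: eq_bigr => x _; rewrite mulrCA.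
Qed.

Lemma expect_mset0 (A : choiceType) (f : A -> R) : expect mset0 f = 0.
Proof. by rewrite /expect enum_mset0 big_nil. Qed.

Lemma expect_msetD (A : choiceType) (m1 m2 : {mset R * A}%mset) (f : A -> R) :
  expect (m1 `+` m2)%mset f = expect m1 f + expect m2 f.
Proof.
have e : perm_eq (enum_mset (m1 `+` m2)%mset) (enum_mset m1 ++ enum_mset m2).
  by apply/allP => x _ /=; rewrite count_cat !count_mem_mset msetE2.
by rewrite /expect (perm_big _ e) big_cat.
Qed.

Lemma expect_mscale (A : choiceType) (p : R) (m : {mset R * A}%mset)
    (f : A -> R) :
  expect (Defs.mscale p m) f = p * expect m f.
Proof.
rewrite /expect (perm_big _ (perm_eq_seq_mset _)) big_map big_distrr /=.
by apply: eq_bigr => x _; rewrite mulrA.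
Qed.

Lemma expect_mixture (A : choiceType) (k : nat) (p : 'I_k -> R)
    (ms : 'I_k -> {mset R * A}%mset) (f : A -> R) :
  expect (\big[msetD/mset0]_(j < k) Defs.mscale (p j) (ms j)) f =
  \sum_(j < k) p j * expect (ms j) f.
Proof.
apply: (big_rec2 (fun m s => expect m f = s)); first exact: expect_mset0.
by move=> j s m _ <-; rewrite expect_msetD expect_mscale.
Qed.

Lemma mixture_is_fdist (A : choiceType) (k : nat) (p : 'I_k -> R)
    (mus : 'I_k -> fdist R A) :
  (forall j, 0 < p j <= 1) -> \sum_(j < k) p j = 1 ->
  is_fdist (\big[msetD/mset0]_(j < k) Defs.mscale (p j) (mus j)).
Proof.
move=> p01 p1; apply/andP; split; last first.
  (* The total mass is the expectation of the constant 1, so linearity applies. *)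
  apply/eqP; transitivity
    (expect (\big[msetD/mset0]_(j < k) Defs.mscale (p j) (mus j)) (fun=> 1)).
    by apply: eq_bigr => x _; rewrite mulr1.
  rewrite expect_mixture -[RHS]p1.
  by apply: eq_bigr => j _; rewrite expect_const mulr1.
apply/allP => x.
apply: (big_ind (fun m : {mset R * A}%mset => x \in m -> 0 < x.1 <= 1)).
- by rewrite in_mset0.
- by move=> m1 m2 h1 h2 /msetDP[/h1|/h2].
- move=> j _; rewrite mem_mset_map => /mapP[y ymu ->] /=.
  have /andP[/allP/(_ _ ymu)/andP[y0 y1] _] := fdist_mset_subproof (mus j).
  have /andP[q0 q1] := p01 j.
  by rewrite mulr_gt0//= mulr_ile1// ltW.
Qed.

End Expectation.

(** * Strategy independence from the strong diamond property *)

Section StrongDiamond.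
Variables (R : realType) (A : choiceType) (step : A -> fdist R A -> Prop).

(* Two steps with independent random outcomes: performing either one leaves *)
(* the other enabled in every outcome, and the pair of outcomes [(x, y)]     *)
(* leads to [h x y] in whichever order the steps are performed.              *)
Definition independent_steps (mu1 mu2 : fdist R A) : Prop :=
  exists (rho1 rho2 : fdist R A) (f g : A -> A) (h : A -> A -> A),
    [/\ mu1 = fdist_map f rho1, mu2 = fdist_map g rho2,
        forall x, x \in supp rho1 -> step (f x) (fdist_map (h x) rho2) &
        forall y, y \in supp rho2 -> step (g y) (fdist_map (h^~ y) rho1)].

Definition strong_diamond : Prop := forall a mu1 mu2,
  step a mu1 -> step a mu2 -> mu1 = mu2 \/ independent_steps mu1 mu2.

Lemma independent_steps_sym mu1 mu2 :
  independent_steps mu1 mu2 -> independent_steps mu2 mu1.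
Proof.
move=> [r1 [r2 [f [g [h [e1 e2 h1 h2]]]]]].
by exists r2, r1, g, f, (fun x y => h y x).
Qed.

(** Follows one strategy, fixed by the choice operator [cid]; under the diamond hypothesis the value
    does not depend on that choice. *)
Fixpoint nf_prob_after (n : nat) (a : A) : R :=
  match n with
  | 0%N => `[< nform step a >]%:R
  | n'.+1 => if pselect (exists mu, step a mu) is left e
             then expect (projT1 (cid e)) (nf_prob_after n') else 1
  end.

Lemma nf_prob_expect (mu : fdist R A) :
  nf_prob step mu = expect mu (nf_prob_after 0).
Proof.
rewrite /nf_prob big_mkcond; apply: eq_bigr => x _ /=.
by case: asbool; rewrite ?mulr1 ?mulr0.
Qed.

Lemma nf_prob_after_nform n a : nform step a -> nf_prob_after n a = 1.
Proof.
by case: n => [|n] nfa /=; [rewrite asboolT | case: pselect => // /nfa].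
Qed.

Lemma nf_prob_after0_step a mu : step a mu -> nf_prob_after 0 a = 0.
Proof. by move=> s; rewrite /= asboolF// => nfa; apply: nfa; exists mu. Qed.

(** Each entry of [mu] moves on its own, by a step or by staying put when normal, and the results
    are mixed with the weights of [mu]. *)
Lemma plift_total mu : exists nu, plift step mu nu.
Proof.
pose s := enum_mset mu; pose t := in_tuple s.
have [mu01 mu1] : (forall j, 0 < (tnth t j).1 <= 1) /\
    \sum_(j < size s) (tnth t j).1 = 1.
  have /andP[/allP h /eqP e] := fdist_mset_subproof mu; split=> [j|].
    by apply: h; rewrite mem_tnth.
  by rewrite -[RHS]e [RHS]big_tnth.
have /choice[nu nuP] : forall j : 'I_(size s),
    exists nu, plift step (fdirac R (tnth t j).2) nu.
  move=> j; have [[nu snu]|nfj] := pselect (exists nu, step (tnth t j).2 nu).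
    by exists nu; exact: plift_step.
  by exists (fdirac R (tnth t j).2); exact: plift_nf.
exists (FDist (mixture_is_fdist nu mu01 mu1)).
apply: (plift_conv nuP mu01 mu1) => //.
rewrite -[LHS]seq_mset_id -/s.
(* [mu] must equal the mixture of its point masses as a multiset: first split it into singletons,
   then read each as a scaled Dirac. *)
transitivity (\big[msetD/mset0]_(x <- s) msetn 1 x).
  elim: s {t mu01 mu1 nu nuP} => [|x s IH].
    by rewrite big_nil; apply/msetP => a; rewrite mset_seqE mset0E.
  by rewrite big_cons mset_cons IH.
rewrite big_tnth; apply: eq_bigr => j _; apply/msetP => x.
rewrite /Defs.mscale /mset_map /= enum_msetn /= mset_seqE /= mulr1.
by rewrite -surjective_pairing msetnE addn0 eq_sym; case: eqP.
Qed.

Lemma plift_seq_exists a : exists mu, plift_seq step mu /\ mu 0%N = fdirac R a.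
Proof.
have [next nextP] := choice plift_total.
by exists (fun n => iter n next (fdirac R a)); split=> // n /=.
Qed.

Hypothesis diamond : strong_diamond.

(** Two competing first steps are compared by induction on [n]: each is followed by the other, and
    the two orders average the same joint outcomes [h x y]. *)
Lemma nf_prob_after_step n a mu :
  step a mu -> nf_prob_after n.+1 a = expect mu (nf_prob_after n).
Proof.
move=> amu /=; case: pselect => [e|]; last by case; exists mu.
case: cid => mu' /= amu' {e}.
elim: n a mu mu' amu amu' => [|n IH] a mu mu' amu amu'.
  (* With independent steps every outcome is still reducible, so both sides are 0. *)
  have [->//|[r1 [r2 [f [g [h [-> -> s1 s2]]]]]]] := diamond amu' amu.
  rewrite !expect_map.
  rewrite [LHS](@eq_in_expect _ _ _ _ (fun=> 0)) ?expect_const; last first.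
    by move=> x /s1; exact: nf_prob_after0_step.
  rewrite [RHS](@eq_in_expect _ _ _ _ (fun=> 0)) ?expect_const//.
  by move=> x /s2; exact: nf_prob_after0_step.
(* The induction hypothesis lets any step, not only the chosen one, unfold [nf_prob_after]. *)
have step_eq b nu : step b nu ->
    nf_prob_after n.+1 b = expect nu (nf_prob_after n).
  move=> bnu /=; case: pselect => [e|]; last by case; exists nu.
  by case: cid => nu' /= bnu'; exact: (IH _ _ _ bnu bnu').
have [->//|[r1 [r2 [f [g [h [-> -> s1 s2]]]]]]] := diamond amu' amu.
rewrite !expect_map.
rewrite [LHS](@eq_in_expect _ _ _ _
    (fun x => expect r2 (fun y => nf_prob_after n (h x y)))); last first.
  by move=> x /s1 /step_eq; rewrite expect_map.
rewrite exchange_expect; apply/esym/eq_in_expect => y /s2 /step_eq.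
by rewrite expect_map.
Qed.

(** Makes the expectation of [nf_prob_after] with the remaining number of steps an invariant of
    lifted sequences. *)
Lemma plift_expect n mu nu : plift step mu nu ->
  expect mu (nf_prob_after n.+1) = expect nu (nf_prob_after n).
Proof.
elim=> [a nfa|a xi s|k p mus nus {}mu {}nu _ IH _ _ -> ->].
- by rewrite !expect_dirac !nf_prob_after_nform.
- by rewrite expect_dirac; exact: nf_prob_after_step.
- by rewrite !expect_mixture; apply: eq_bigr => j _; rewrite IH.
Qed.

Lemma nf_prob_plift_seq (mu : nat -> fdist R A) n : plift_seq step mu ->
  nf_prob step (mu n) = expect (mu 0%N) (nf_prob_after n).
Proof.
move=> mus; have shift k : expect (mu n) (nf_prob_after k) =
    expect (mu 0%N) (nf_prob_after (n + k)).
  by elim: n k => [//|n IH] k; rewrite addSnnS -IH -(plift_expect _ (mus n)).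
by rewrite nf_prob_expect shift addn0.
Qed.

Lemma nf_prob_plift_seq_dirac (mu : nat -> fdist R A) a n :
  plift_seq step mu -> mu 0%N = fdirac R a ->
  nf_prob step (mu n) = nf_prob_after n a.
Proof.
by move=> mus mu0; rewrite nf_prob_plift_seq// mu0 expect_dirac.
Qed.

Lemma AST_iff_wAST : AST step <-> wAST step.
Proof.
split=> [ast a|wast mu mus].
  have [mu [mus mu0]] := plift_seq_exists a.
  by exists mu; split=> //; exact: ast.
have lim1 a : nf_prob_after n a @[n --> \oo] --> (1 : R).
  have [nu [nus nu0]] := wast a.
  by under eq_cvg do rewrite (nf_prob_plift_seq_dirac _ nus nu0).
under eq_cvg do rewrite nf_prob_plift_seq//.
(* Writing the limit as an expectation over [mu 0] reduces the claim to termwise limits in a finite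
   weighted sum. *)
rewrite -(expect_const (mu 0%N) 1) /expect.
apply: cvg_big => [|x _]; first exact: add_continuous.
by apply: cvgMr; exact: lim1.
Qed.

Lemma PAST_iff_wPAST : PAST step <-> wPAST step.
Proof.
split=> [past a|wpast mu a mus mu0].
  have [mu [mus mu0]] := plift_seq_exists a.
  by exists mu; split=> //; exact: (past mu a).
have [nu [nus nu0 nufin]] := wpast a; apply: le_lt_trans nufin.
rewrite /edl (@eq_eseriesr _ _ (fun n => (1 - nf_prob step (nu n))%:E))// => n _.
by rewrite !(nf_prob_plift_seq_dirac _ _ mu0, nf_prob_plift_seq_dirac _ _ nu0).
Qed.

End StrongDiamond.


(** * Positions and substitutions in linear terms *)

Lemma uniq_flatten_map (I T : eqType) (h : I -> seq T) (s : seq I) :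
  uniq (flatten [seq h i | i <- s]) ->
  {in s, forall i, uniq (h i)} /\
  {in s &, forall i j x, x \in h i -> x \in h j -> i = j}.
Proof.
elim: s => [|i s IH] //=; rewrite cat_uniq => /and3P[ui /hasPn dis /IH[us ds]].
have sep j x : j \in s -> x \in h i -> x \in h j -> False.
  move=> js xi xj; have := dis x; rewrite xi => /(_ _)/negP; apply=> //.
  by apply/flattenP; exists (h j) => //; exact: map_f.
split=> [j|j1 j2]; first by rewrite inE => /predU1P[->//|/us].
rewrite !inE => /predU1P[->|j1s] /predU1P[->|j2s] x //.
- by move=> xi xj; case: (sep j2 x).
- by move=> xi xj; case: (sep j1 x).
- exact: ds.
Qed.

Section TermLemmas.
Variables (F : countType) (ar : F -> nat).

Lemma App_ext (V : Type) (f : F) (ts us : 'I_(ar f) -> term ar V) :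
  (forall i, ts i = us i) -> App ts = App us.
Proof. by move=> /funext ->. Qed.

(* Not convertible: [subterm_at] and [replace_at] recurse on the term. *)
Lemma subterm_at0 (V : Type) (t : term ar V) : subterm_at t [::] = Some t.
Proof. by case: t. Qed.

Lemma replace_at0 (V : Type) (t u : term ar V) : replace_at t [::] u = u.
Proof. by case: t. Qed.

Lemma App_inj (V : Type) (f : F) (ts us : 'I_(ar f) -> term ar V) :
  App ts = App us -> ts = us.
Proof.
move=> e; apply: funext => i.
(* Reading the argument through [subterm_at] avoids an equality of dependent pairs over [f]; the
   default is never reached on the two terms at hand. *)
pose arg (t : term ar V) := odflt t (subterm_at t [:: val i]).
have : arg (App ts) = arg (App us) by rewrite e.
by rewrite /arg /= !valK !subterm_at0.
Qed.

Lemma subst_comp (U V W : Type) (s : V -> term ar W) (r : U -> term ar V)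
    (t : term ar U) :
  subst s (subst r t) = subst (fun x => subst s (r x)) t.
Proof. by elim: t => //= f ts IH; apply: App_ext. Qed.

Lemma subst_rename (U V W : Type) (s : V -> term ar W) (r : U -> V)
    (t : term ar U) :
  subst s (rename r t) = subst (s \o r) t.
Proof. exact: subst_comp. Qed.

Variable V : countType.
Implicit Types (s t u : term ar V) (sigma tau : V -> term ar V).

Lemma vars_App (f : F) (ts : 'I_(ar f) -> term ar V) x :
  x \in vars (App ts) <-> exists i, x \in vars (ts i).
Proof.
split=> [/flattenP[_ /mapP[i _ ->] xi]|[i xi]]; first by exists i.
by apply/flattenP; exists (vars (ts i)) => //; apply: map_f; rewrite mem_enum.
Qed.

Lemma uniq_vars_App (f : F) (ts : 'I_(ar f) -> term ar V) :
  uniq (vars (App ts)) ->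
  (forall i, uniq (vars (ts i))) /\
  (forall i j x, x \in vars (ts i) -> x \in vars (ts j) -> i = j).
Proof.
move=> /uniq_flatten_map[u d]; split=> [i|i j]; first by apply: u; rewrite mem_enum.
by apply: d; rewrite mem_enum.
Qed.

Lemma eq_in_subst sigma tau t :
  {in vars t, sigma =1 tau} -> subst sigma t = subst tau t.
Proof.
elim: t => [x|f ts IH] e /=; first by apply: e; rewrite inE.
by apply: App_ext => i; apply: IH => x xi; apply: e; apply/vars_App; exists i.
Qed.

Lemma subst_inj_vars sigma tau t :
  subst sigma t = subst tau t -> {in vars t, sigma =1 tau}.
Proof.
elim: t => [x|f ts IH] /= e y; first by rewrite inE => /eqP ->.
by case/vars_App=> i; apply: IH; have := congr1 (@^~ i) (App_inj e).
Qed.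

Lemma subterm_at_cat t p q :
  subterm_at t (p ++ q) = if subterm_at t p is Some u then subterm_at u q else None.
Proof.
elim: p t => [t|i p IH [x|f ts]] //=; first by rewrite subterm_at0.
by case: insub.
Qed.

Lemma subterm_at_vars t p x : subterm_at t p = Some (Var ar x) -> x \in vars t.
Proof.
elim: p t => [|i p IH] [y|f ts] //=; first by move=> [->]; rewrite inE.
by case: insubP => // j _ _ /IH xj; apply/vars_App; exists j.
Qed.

Lemma vars_subterm_at t x :
  x \in vars t -> exists p, subterm_at t p = Some (Var ar x).
Proof.
elim: t => [y|f ts IH]; first by rewrite inE => /eqP ->; exists [::].
by case/vars_App=> i /IH[p pi]; exists (val i :: p); rewrite /= valK.
Qed.

Lemma subterm_at_subst sigma t p u : subterm_at t p = Some u ->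
  subterm_at (subst sigma t) p = Some (subst sigma u).
Proof.
elim: p t => [|i p IH] t; first by rewrite !subterm_at0 => -[->].
by case: t => [x|f ts] //=; case: insub => // j /IH.
Qed.

(** The case split of critical pair analysis; a variable position of [t] itself falls in the second
    case, with [p2] empty. *)
Lemma subterm_at_substP sigma t p w :
  subterm_at (subst sigma t) p = Some w ->
  (exists u, [/\ subterm_at t p = Some u, ~~ is_var u & subst sigma u = w]) \/
  (exists p1 p2 x, [/\ p = p1 ++ p2, subterm_at t p1 = Some (Var ar x) &
     subterm_at (sigma x) p2 = Some w]).
Proof.
elim: t p => [x|f ts IH] p; first by right; exists [::], p, x.
case: p => [|i p] /=; first by case=> <-; left; exists (App ts).
case: insubP => // j _ ji /IH[[u [pu nu uw]]|[p1 [p2 [x [-> p1x p2w]]]]].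
  by left; exists u.
by right; exists (i :: p1), p2, x; split=> //=; rewrite -ji valK.
Qed.

Definition supdate sigma (x : V) u : V -> term ar V :=
  fun y => if y == x then u else sigma y.

(** By linearity the occurrence of [x] at [p] is the only one, so updating [sigma] at [x] changes
    nothing else. *)
Lemma replace_at_subst sigma t p q x v :
  uniq (vars t) -> subterm_at t p = Some (Var ar x) ->
  replace_at (subst sigma t) (p ++ q) v =
  subst (supdate sigma x (replace_at (sigma x) q v)) t.
Proof.
elim: p t => [|i p IH] [y|f ts] //=.
  by move=> _ [->]; rewrite /supdate eqxx.
case: insubP => // j _ <- /uniq_vars_App[ut dt] px; apply: App_ext => k.
have [/val_inj ->|jk] := eqVneq; first exact: IH.
apply: eq_in_subst => z zk; rewrite /supdate; case: eqP => // zx; subst z.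
by case/eqP: jk; rewrite (dt _ _ _ zk (subterm_at_vars px)).
Qed.

End TermLemmas.

(** * The strong diamond property of rewriting *)

Section Rewriting.
Variables (R : realType) (F : countType) (ar : F -> nat) (V : countType).
Variable P : set (prule R ar V).

Definition plug (f : F) (ts : 'I_(ar f) -> term ar V) (i : 'I_(ar f))
    (u : term ar V) : term ar V :=
  App (fun j => if val j == val i then u else ts j).

Lemma replace_at_plug f ts (i : 'I_(ar f)) p (u : term ar V) :
  replace_at (App ts) (val i :: p) u = plug ts i (replace_at (ts i) p u).
Proof.
by apply: App_ext => j; have [/val_inj ->|] := eqVneq.
Qed.

Lemma replace_at_in_plug f ts (i : 'I_(ar f)) p (u v : term ar V) :
  replace_at (plug ts i u) (val i :: p) v = plug ts i (replace_at u p v).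
Proof. by apply: App_ext => j /=; case: eqP. Qed.

Lemma rew_plug f ts (i : 'I_(ar f)) (s : term ar V) mu :
  rew P s mu -> rew P (plug ts i s) (fdist_map (plug ts i) mu).
Proof.
move=> [p [r [sigma [Pr sp ->]]]]; exists (val i :: p), r, sigma; split=> //.
  by rewrite /= valK eqxx.
rewrite fdist_map_comp; apply: eq_in_fdist_map => t _ /=.
by rewrite -replace_at_in_plug.
Qed.

Lemma independent_steps_plug f ts (i : 'I_(ar f)) mu1 mu2 :
  independent_steps (rew P) mu1 mu2 ->
  independent_steps (rew P) (fdist_map (plug ts i) mu1)
                            (fdist_map (plug ts i) mu2).
Proof.
move=> [r1 [r2 [g1 [g2 [h [-> -> s1 s2]]]]]].
exists r1, r2, (plug ts i \o g1), (plug ts i \o g2),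
  (fun x y => plug ts i (h x y)); rewrite !fdist_map_comp; split=> // x xr.
  by have := rew_plug ts i (s1 x xr); rewrite fdist_map_comp.
by have := rew_plug ts i (s2 x xr); rewrite fdist_map_comp.
Qed.

Lemma parallel_steps f ts (i j : 'I_(ar f)) mu1 mu2 : i != j ->
  rew P (ts i) mu1 -> rew P (ts j) mu2 ->
  independent_steps (rew P) (fdist_map (plug ts i) mu1)
                            (fdist_map (plug ts j) mu2).
Proof.
move=> ij st1 st2.
(* The arguments left after the [k]-th has become [u]; the joint outcome replaces both arguments. *)
pose ts' (k : 'I_(ar f)) u (l : 'I_(ar f)) := if val l == val k then u else ts l.
exists mu1, mu2, (plug ts i), (plug ts j), (fun x y => plug (ts' i x) j y).
split=> // x _.
  have := rew_plug (ts' i x) j st2; congr rew; apply: App_ext => k /=.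
  rewrite /ts'; case: eqVneq => // /val_inj ->.
  by rewrite (inj_eq val_inj) eq_sym (negbTE ij).
have := rew_plug (ts' j x) i st1; congr rew.
  apply: App_ext => k /=; rewrite /ts'; case: eqVneq => // /val_inj ->.
  by rewrite (inj_eq val_inj) (negbTE ij).
apply: eq_in_fdist_map => y _; apply: App_ext => k /=; rewrite /ts'.
case: eqVneq => // /val_inj ->.
by rewrite (inj_eq val_inj) (negbTE ij).
Qed.

Hypothesis P_prule : forall r, P r -> is_prule r.
Hypothesis P_nonoverlapping : non_overlapping P.
Hypothesis P_linear : linear_ptrs P.
Hypothesis P_nonerasing : non_erasing P.

Lemma overlap_trivial r1 r2 p u (sigma1 sigma2 : V -> term ar V) : P r1 -> P r2 ->
  subterm_at r1.1 p = Some u -> ~~ is_var u ->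
  subst sigma1 u = subst sigma2 r2.1 -> r1 = r2 /\ p = [::].
Proof.
move=> Pr1 Pr2 pu nu e; apply: contrapT => no.
apply: (P_nonoverlapping Pr1 Pr2 pu nu); first by move=> ? ?; exact: no.
(* The two matching substitutions act on separate copies of the variables, which glues them into one
   unifier; [inl] only moves their values into [V + V]. *)
exists (fun z => match z with
                 | inl x => rename inl (sigma1 x)
                 | inr y => rename inl (sigma2 y)
                 end).
rewrite !subst_rename; have := congr1 (rename (@inl V V)) e.
by rewrite /rename !subst_comp.
Qed.

(** A second redex inside the pattern of [r1.1] would be an overlap, hence is the root redex itself;
    otherwise it lies in the instance of some variable [x] and the steps commute. *)
Lemma root_diamond r1 (sigma1 : V -> term ar V) mu2 : P r1 ->
  rew P (subst sigma1 r1.1) mu2 ->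
  fdist_map (subst sigma1) r1.2 = mu2 \/
  independent_steps (rew P) (fdist_map (subst sigma1) r1.2) mu2.
Proof.
move=> Pr1 [p [r2 [sigma2 [Pr2 sp ->]]]].
have [[u [pu nu uw]]|[p1 [p2 [x [pE p1x p2w]]]]] := subterm_at_substP sp.
  (* Both substitutions agree on the variables of the left-hand side, which contain those of every
     right-hand side. *)
  have [? ?] := overlap_trivial Pr1 Pr2 pu nu uw; subst r2 p; left.
  move: sp; rewrite subterm_at0 => -[] /subst_inj_vars e.
  apply: eq_in_fdist_map => t tr; rewrite replace_at0.
  apply: eq_in_subst => y yt; apply: e.
  by have [_ h] := P_prule Pr1; apply: (h t).
right; subst p.
have [lin1 linr1] := P_linear Pr1.
pose h t u := subst (supdate sigma1 x (replace_at (sigma1 x) p2 (subst sigma2 u))) t.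
exists r1.2, r2.2, (subst sigma1),
  (fun u => replace_at (subst sigma1 r1.1) (p1 ++ p2) (subst sigma2 u)), h.
split=> // [t tr|u ur].
  (* Non-erasure keeps a copy of the inner redex in [t], and right-linearity makes it the only
     one. *)
  have /vars_subterm_at[q qx] : x \in vars t.
    by apply: (P_nonerasing Pr1 tr); exact: subterm_at_vars p1x.
  exists (q ++ p2), r2, sigma2; split=> //.
    by rewrite subterm_at_cat (subterm_at_subst _ qx).
  apply: eq_in_fdist_map => u _.
  by rewrite (replace_at_subst _ _ _ (linr1 _ tr) qx).
(* By left-linearity the root still matches [r1.1] after the inner step, with [sigma1] updated at
   [x]. *)
exists [::], r1, (supdate sigma1 x (replace_at (sigma1 x) p2 (subst sigma2 u))).
split=> //=; first by rewrite subterm_at0 (replace_at_subst _ _ _ lin1 p1x).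
by apply: eq_in_fdist_map => t _; rewrite replace_at0.
Qed.

(** Induction on the first position: a redex at the root is handled by [root_diamond], two redexes
    in one argument by the hypothesis under a context, and those in distinct arguments are
    parallel. *)
Lemma rew_strong_diamond : strong_diamond (rew P).
Proof.
move=> s mu1 mu2 [p1 [r1 [sigma1 [Pr1 sp1 ->]]]].
elim: p1 s sp1 mu2 => [|i p1 IH] s sp1 mu2 st2.
  move: sp1 st2; rewrite subterm_at0 => -[->] /(root_diamond Pr1).
  by under eq_fun do rewrite replace_at0.
move: (st2) => [[|j p2] [r2 [sigma2 [Pr2 sp2 mu2E]]]].
  rewrite mu2E; move: sp2 sp1 {st2 mu2E}; rewrite subterm_at0 => -[->] sp1.
  under [X in _ = fdist_map X _]eq_fun do rewrite replace_at0.
  under [X in independent_steps _ _ (fdist_map X _)]eq_fun do rewrite replace_at0.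
  (* Here the second redex is the root, so the roles are swapped and symmetry is used. *)
  have := @root_diamond r2 sigma2 _ Pr2
    (ex_intro _ (i :: p1) (ex_intro _ r1 (ex_intro _ sigma1 (And3 Pr1 sp1 erefl)))).
  by move=> [->|/independent_steps_sym]; [left|right].
case: s sp1 sp2 st2 mu2E => [//|f ts] /=.
case: insubP => // i' _ <- sp1; case: insubP => // j' _ <- sp2 _ ->.
have mapE (k : 'I_(ar f)) p (r : prule R ar V) sigma :
    fdist_map (fun t => replace_at (App ts) (val k :: p) (subst sigma t)) r.2 =
    fdist_map (plug ts k)
      (fdist_map (fun t => replace_at (ts k) p (subst sigma t)) r.2).
  rewrite fdist_map_comp; apply: eq_in_fdist_map => t _.
  exact: replace_at_plug.
rewrite !mapE.
have st2 : rew P (ts j') (fdist_map (fun t => replace_at (ts j') p2 (subst sigma2 t)) r2.2).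
  by exists p2, r2, sigma2.
have [ij|ij] := eqVneq i' j'.
  subst j'; have [->|/independent_steps_plug] := IH _ sp1 _ st2; first by left.
  by right.
right; apply: (parallel_steps ij) => //.
by exists p1, r1, sigma1.
Qed.

End Rewriting.

Theorem theorem4p9 (R : realType) (F : countType) (ar : F -> nat)
    (V : countType) (P : set (prule R ar V)) :
  is_ptrs P -> non_overlapping P -> linear_ptrs P -> non_erasing P ->
  (AST (rew P) <-> wAST (rew P)) /\ (PAST (rew P) <-> wPAST (rew P)).
Proof.
move=> [_ Pr] no lin ne; have diamond := rew_strong_diamond Pr no lin ne.
by split; [exact: AST_iff_wAST|exact: PAST_iff_wPAST].
Qed.
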